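(* Fix $\epsilon>0$, a positive integer $d$, and a matrix $A(x) \in M_{d \times d}(\mathbb{Z}[x])$ with integer polynomial entries. Then there exists a constant $k = k(\epsilon, A(x), d)>0$ such that the following is true. Suppose $\widetilde{Y} \subset [0,1)^d$ with $|\widetilde{Y}| \geq k$ satisfies the following condition: for all $v \in \mathbb{Z}^d\setminus\{0\}$ and all distinct $\widetilde{y}, \widetilde{y}' \in \widetilde{Y}$, the polynomial $v \cdot (A(x) - A(0))(\widetilde{y}-\widetilde{y}') \in \mathbb{R}[x]$ is not the zero polynomial. Then, letting $Y = \pi_{\mathbb{T}^d}(\widetilde{Y})$, there exists $n \in \mathbb{Z}$ such that $A(n)Y$ is $\epsilon$-dense in $\mathbb{T}^d$.
   Context: $\mathbb{T}^d=\mathbb{R}^d/\mathbb{Z}^d$ and $\pi_{\mathbb{T}^d}:\mathbb{R}^d\to\mathbb{T}^d$ is the quotient map; integer $d\times d$ matrices act on $\mathbb{T}^d$ by matrix multiplication. For $u\in\mathbb{T}^d$, $|u|$ denotes the $\|\cdot\|_\infty$-distance from the origin of $\mathbb{R}^d$ to the closest point of the preimage of $u$ in $\mathbb{R}^d$. A subset $Z\subset\mathbb{T}^d$ is $\epsilon$-dense if for every $\alpha\in\mathbb{T}^d$ there is $z\in Z$ with $|\alpha-z|\le\epsilon$. *)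

(* Defs.v *)
From HB Require Import structures.
From mathcomp Require Import all_boot all_order all_algebra.
From mathcomp Require Import generic_quotient ring_quotient.
From mathcomp Require Import all_classical all_reals all_analysis.

Set Implicit Arguments.
Unset Strict Implicit.
Unset Printing Implicit Defensive.

Import Order.TTheory GRing.Theory Num.Theory.
Import numFieldNormedType.Exports.

Local Open Scope classical_set_scope.
Local Open Scope quotient_scope.
Local Open Scope ring_scope.

Definition int_lattice (R : realType) (d : nat) : pred 'cV[R]_d :=
  fun x => x \is a mxOver (@Num.int R).

Fact int_lattice_zmod_closed (R : realType) (d : nat) :
  zmod_closed (@int_lattice R d).
Proof.
split=> [|x y]; first exact: (@mxOver0 _ _ _ Num.int).
by move=> /mxOverP hx /mxOverP hy; apply/mxOverP => i j; rewrite !mxE rpredB.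
Qed.

HB.instance Definition _ (R : realType) (d : nat) :=
  GRing.isZmodClosed.Build 'cV[R]_d (@int_lattice R d)
    (@int_lattice_zmod_closed R d).

Definition torus (R : realType) (d : nat) :=
  Quotient.quot (GRing.ZmodClosed.clone _ (@int_lattice R d) _).
HB.instance Definition _ (R : realType) (d : nat) :=
  GRing.Zmodule.on (torus R d).

Definition torus_proj {R : realType} {d : nat} (x : 'cV[R]_d) : torus R d :=
  \pi_(torus R d) x.

(* Independent of the representative, see torus_mul_proj. *)
Definition torus_mul {R : realType} {d : nat} (M : 'M[int]_d)
    (u : torus R d) : torus R d :=
  torus_proj (map_mx intr M *m repr u).

(* On matrices, `|x| is the sup norm. The infimum is attained, see
   torus_norm_min. *)
Definition torus_norm {R : realType} {d : nat} (u : torus R d) : R :=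
  inf [set `|x| | x in [set x : 'cV[R]_d | torus_proj x = u]].

Definition eps_dense {R : realType} {d : nat} (eps : R)
    (Z : set (torus R d)) : Prop :=
  forall alpha : torus R d, exists2 z, Z z & torus_norm (alpha - z) <= eps.

Definition eval_mx {d : nat} (A : 'M[{poly int}]_d) (n : int) : 'M[int]_d :=
  map_mx (fun p => p.[n]) A.

Definition mulmx_poly {R : realType} {d : nat} (B : 'M[{poly int}]_d)
    (w : 'cV[R]_d) : 'cV[{poly R}]_d :=
  map_mx (map_poly intr) B *m map_mx polyC w.

Definition int_dot {R : nzRingType} {d : nat} (v : 'cV[int]_d)
    (p : 'cV[R]_d) : R :=
  \sum_i (v i 0)%:~R * p i 0.

Lemma torus_projP (R : realType) (d : nat) (x y : 'cV[R]_d) :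
  torus_proj x = torus_proj y <-> x - y \is a mxOver (@Num.int R).
Proof.
rewrite /torus_proj; split.
  by move/eqP; rewrite -Quotient.idealrBE.
by move=> h; apply/eqP; rewrite -Quotient.idealrBE.
Qed.

Lemma torus_projB (R : realType) (d : nat) (x y : 'cV[R]_d) :
  torus_proj (x - y) = torus_proj x - torus_proj y.
Proof. exact: (raddfB (\pi_(torus R d))). Qed.

Lemma torus_mul_proj (R : realType) (d : nat) (M : 'M[int]_d) (x : 'cV[R]_d) :
  torus_mul M (torus_proj x) = torus_proj (map_mx intr M *m x).
Proof.
apply/torus_projP; rewrite -mulmxBr; apply: mxOverM.
  by apply/mxOverP => i j; rewrite mxE intr_int.
by apply/torus_projP; rewrite /torus_proj reprK.
Qed.

Lemma torus_norm_min (R : realType) (d : nat) (u : torus R d) :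
  exists2 x : 'cV[R]_d, torus_proj x = u & torus_norm u = `|x| /\
    forall y, torus_proj y = u -> `|x| <= `|y|.
Proof.
suff [x xu xmin] : exists2 x : 'cV[R]_d, torus_proj x = u &
    forall y, torus_proj y = u -> `|x| <= `|y|.
  exists x => //; split=> //; apply/eqP; rewrite eq_le; apply/andP; split.
    apply: ge_inf; last by exists x.
    by exists 0 => _ [y _ <-].
  apply: lb_le_inf; first by exists `|x|, x.
  by move=> _ [y yu <-]; exact: xmin.
have round (t : R) : exists m : int, forall n : int, `|t - m%:~R| <= `|t - n%:~R|.
  have f0 := Num.Theory.ge_floor t; have f1 := Num.Theory.floorD1_gt t.
  set f := Num.floor t in f0 f1.
  have near n : `|t - f%:~R| <= `|t - n%:~R| \/
                `|t - (f + 1)%:~R| <= `|t - n%:~R|.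
    have [nf|nf] := leP n f; [left | right].
      have nf' : n%:~R <= f%:~R :> R by rewrite ler_int.
      rewrite !ger0_norm ?subr_ge0 ?lerD2l ?lerN2 //.
      exact: le_trans nf' f0.
    have nf' : (f + 1)%:~R <= n%:~R :> R by rewrite ler_int lezD1.
    rewrite !ler0_norm ?subr_le0 ?lerN2 ?lerD2l ?lerN2 //; last exact: ltW.
    exact: le_trans (ltW f1) nf'.
  have [le|/ltW le] := leP `|t - f%:~R| `|t - (f + 1)%:~R|.
    by exists f => n; case: (near n) => // /(le_trans le).
  by exists (f + 1) => n; case: (near n) => // /(le_trans le).
have [r rP] := choice round.
pose z : 'cV[R]_d := repr u.
pose x : 'cV[R]_d := \col_i (z i 0 - (r (z i 0))%:~R).
have zu : torus_proj z = u by rewrite /torus_proj reprK.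
exists x.
  rewrite -zu; apply/torus_projP/mxOverP => i j.
  by rewrite !mxE ord1 addrAC subrr add0r rpredN intr_int.
move=> y; rewrite -zu => /torus_projP/mxOverP yz.
rewrite [leLHS]/Num.Def.normr [leRHS]/Num.Def.normr /= !mx_normrE.
apply: bigmax_le => [|[i j] _ /=]; first exact: bigmax_ge_id.
apply: le_trans (le_bigmax _ _ (i, j)) => /=; rewrite ord1.
have /intrP[m mE] := yz i 0.
rewrite mxE (le_trans (rP _ (- m))) // intrN opprK -mE !mxE.
by rewrite addrCA subrr addr0.
Qed.

(* Main.v *)
Require Import Defs.
From mathcomp Require Import all_boot all_order all_algebra.
From mathcomp Require Import all_classical all_reals all_analysis.
From mathcomp Require Import ring lra zify.

Set Implicit Arguments.
Unset Strict Implicit.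
Unset Printing Implicit Defensive.

Import Order.TTheory GRing.Theory Num.Theory.
Import numFieldNormedType.Exports.

Local Open Scope classical_set_scope.
Local Open Scope ring_scope.

(** Suppose that A(n)Y misses a ball around alpha(n) for every n.  A fixed
trigonometric polynomial that is tiny off the ball and has positive mean
([fourier_obstruction]) detects this: for some nonzero frequency v in a finite
list V, depending only on eps and d, the k points A(n)y are not equidistributed
along v.  Squaring the exponential sum over the points removes the unknown
centre alpha(n) and leaves ([fourier_energy]) a lower bound of order k^2,
valid for every n, for the sum over v in V and over pairs y, y' of
cos (2 pi P(n)), where P(n) = v . A(n)(y' - y) is a real polynomial in n.

One then averages over n.  By Weyl differencing ([cancels_poly]) the average of
cos (2 pi P) is at most a prescribed eta, unless all nonconstant coefficients
of P become integers after multiplication by some L which depends only on eta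
and on the degree.  The exceptional pairs are few: the points lie in the unit
cube, so the coefficients of L P are bounded integers, and for fixed y the
hypothesis on v . (A(x) - A(0))(y - y') makes distinct y' give distinct
nonconstant coefficients.  Hence each y has a bounded number of exceptional
partners ([count_near_integral]), the average over n is at most
eta k^2 |V| + O(k), and this contradicts the lower bound once k is large.

Two devices keep limits and complex numbers out of the argument.  Averages over
n are taken along finite multisets of integers, with bounds uniform in
translation ([mean_le]); such bounds add up, by averaging along sumsets.  And
the modulus of an exponential sum is read off as the largest value over
all phases phi of the corresponding sum of cosines shifted by phi
([cancels]). *)

(** * Cosine sums *)

Definition ecos {R : realType} (x : R) : R := cos (pi *+ 2 * x).

Lemma ecosDz (R : realType) (x : R) (m : int) : ecos (x + m%:~R) = ecos x.
Proof.
have ecosDn y (n : nat) : ecos (y + n%:R) = ecos y :> R.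
  by rewrite /ecos mulrDr mulr_natr periodicn //; exact: cosD2pi.
case: m => n; first by rewrite -pmulrn ecosDn.
by rewrite NegzE mulrNz -pmulrn -[in RHS](subrK n.+1%:R x) ecosDn.
Qed.

Lemma ecos_le1 (R : realType) (x : R) : ecos x <= 1.
Proof. exact: cos_le1. Qed.

Lemma ecos0 (R : realType) : ecos (0 : R) = 1.
Proof. by rewrite /ecos mulr0 cos0. Qed.

Lemma ecosDB (R : realType) (x y : R) :
  ecos (x + y) + ecos (x - y) = 2 * ecos x * ecos y.
Proof. by rewrite /ecos mulrDr mulrBr cosD cosB; ring. Qed.

(** The right side is the squared modulus of the exponential sum with phases
[x i], of which the left side is the squared real part after a rotation. *)
Lemma sqr_sum_ecos_le (R : realType) (I : Type) (s : seq I) (x : I -> R) (phi : R) :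
  (\sum_(i <- s) ecos (x i + phi)) ^+ 2 <=
  \sum_(i <- s) \sum_(j <- s) ecos (x i - x j).
Proof.
pose y i := pi *+ 2 * (x i + phi).
have -> : \sum_(i <- s) \sum_(j <- s) ecos (x i - x j) =
    (\sum_(i <- s) cos (y i)) ^+ 2 + (\sum_(i <- s) sin (y i)) ^+ 2.
  rewrite !expr2 !mulr_suml -big_split; apply: eq_bigr => i _ /=.
  rewrite !mulr_sumr -big_split; apply: eq_bigr => j _ /=.
  by rewrite -cosB -mulrBr; congr (cos (_ * _)); ring.
by rewrite lerDl sqr_ge0.
Qed.

Lemma sin_pi_neq0 (R : realType) (a : R) : a \isn't a Num.int -> sin (pi * a) != 0.
Proof.
move=> aN.
have a0 : 0 < a - (Num.floor a)%:~R.
  rewrite lt_neqAle subr_ge0 floor_le andbT eq_sym subr_eq0.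
  by apply: contraNneq aN => ->; rewrite intr_int.
have a1 : a - (Num.floor a)%:~R < 1 by rewrite ltrBlDl -intrD1 floorD1_gt.
have : sin (pi * (a - (Num.floor a)%:~R)) != 0.
  rewrite gt_eqF// sin_gt0_pi// mulr_gt0 ?pi_gt0//=.
  by rewrite -[ltRHS]mulr1 ltr_pM2l ?pi_gt0.
have sin_int (m : int) : sin (pi * m%:~R) = 0 :> R.
  have sin_nat (n : nat) : sin (pi * n%:R) = 0 :> R.
    by rewrite mulr_natr -[_ *+ _]add0r alternatingn ?sin0 ?mulr0//; exact: sinDpi.
  case: m => n; first by rewrite -pmulrn sin_nat.
  by rewrite NegzE mulrNz mulrN sinN -pmulrn sin_nat oppr0.
by rewrite mulrBr sinB sin_int mulr0 subr0 mulf_eq0 => /norP[].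
Qed.

(** A geometric sum: after multiplication by [2 * sin (pi * a)] it telescopes to
a difference of two sines. *)
Lemma sum_ecos_arith_le (R : realType) (a b : R) (H : nat) :
  `|sin (pi * a)| * (\sum_(h < H) ecos (a * h%:R + b)) <= 1.
Proof.
pose u (h : nat) := sin (pi *+ 2 * (a * h%:R + b) - pi * a).
have tele : 2 * sin (pi * a) * (\sum_(h < H) ecos (a * h%:R + b)) = u H - u 0%N.
  rewrite -(big_mkord xpredT (fun h : nat => ecos (a * h%:R + b))).
  rewrite -telescope_sumr// mulr_sumr; apply: eq_bigr => h _.
  have -> : u h.+1 = sin (pi *+ 2 * (a * h%:R + b) + pi * a).
    rewrite /u -natr1; congr sin; rewrite -mulr_natr; ring.
  by rewrite /u /ecos sinD sinB; ring.
have le2 : `|2 * sin (pi * a) * (\sum_(h < H) ecos (a * h%:R + b))| <= 2.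
  rewrite tele (le_trans (ler_normB _ _))// -[leRHS]/(1 + 1).
  by rewrite lerD// sin_max.
rewrite -mulrA normrM normrM ger0_norm// in le2.
have : `|sin (pi * a)| * `|\sum_(h < H) ecos (a * h%:R + b)| <= 1 by lra.
by apply: le_trans; rewrite ler_wpM2l// ler_norm.
Qed.

(** * Translation-uniform averages and differencing *)

Lemma sum_seq_cst (R : realType) (I : Type) (s : seq I) (c : R) :
  \sum_(i <- s) c = (size s)%:R * c.
Proof. by rewrite big_const_seq count_predT iter_addr_0 mulr_natl. Qed.

(** The bound holds for all translates of one finite averaging multiset, which
is what allows two averages to be combined; the step [q] leaves room to average
along a progression. *)
Definition mean_le {R : realType} (q : nat) (f : int -> R) (c : R) : Prop :=
  exists2 T : seq int, T != [::] &
    forall m, \sum_(t <- T) f (m + t *+ q) <= (size T)%:R * c.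

(** Uniformity in [phi] turns this into a bound on the modulus of the average of
the exponentials of [theta]. *)
Definition cancels {R : realType} (q : nat) (theta : int -> R) (eta : R) : Prop :=
  exists2 T : seq int, T != [::] &
    forall m phi, \sum_(t <- T) ecos (theta (m + t *+ q) + phi) <= (size T)%:R * eta.

Lemma mean_le_cst (R : realType) (q : nat) (f : int -> R) (c : R) :
  (forall n, f n <= c) -> mean_le q f c.
Proof.
by move=> fc; exists [:: 0] => // m; rewrite big_seq1 mul1r.
Qed.

Lemma mean_leW (R : realType) (q : nat) (f g : int -> R) (a b : R) :
  (forall n, g n <= f n) -> a <= b -> mean_le q f a -> mean_le q g b.
Proof.
move=> gf ab [T T0 fT]; exists T => // m.
apply: (@le_trans _ _ (\sum_(t <- T) f (m + t *+ q))); first exact: ler_sum.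
by rewrite (le_trans (fT m))// ler_wpM2l.
Qed.

(** Average along the sumset of the two multisets: translation uniformity of
either bound survives the extra averaging. *)
Lemma mean_leD (R : realType) (q : nat) (f g : int -> R) (a b : R) :
  mean_le q f a -> mean_le q g b -> mean_le q (fun n => f n + g n) (a + b).
Proof.
move=> [T T0 fT] [U U0 gU].
exists [seq t + u | t <- T, u <- U].
  by rewrite -size_eq0 size_allpairs muln_eq0 !size_eq0 negb_or T0.
move=> m; rewrite size_allpairs big_allpairs_dep.
under eq_bigr do rewrite big_split.
rewrite big_split mulrDr natrM; apply: lerD => /=.
  rewrite exchange_big mulrAC mulrC -sum_seq_cst.
  apply: ler_sum => u _; apply: le_trans (fT (m + u *+ q)).
  by apply: ler_sum => t _; rewrite mulrnDl [_ *+ q + _]addrC addrA.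
rewrite -mulrA -sum_seq_cst.
apply: ler_sum => t _; apply: le_trans (gU (m + t *+ q)).
by apply: ler_sum => u _; rewrite mulrnDl addrA.
Qed.

Lemma mean_le_sum (R : realType) (I : eqType) (q : nat) (s : seq I)
    (f : I -> int -> R) (c : I -> R) :
  (forall i, i \in s -> mean_le q (f i) (c i)) ->
  mean_le q (fun n => \sum_(i <- s) f i n) (\sum_(i <- s) c i).
Proof.
elim: s => [|i s IHs] fc.
  by rewrite big_nil; apply: mean_le_cst => n; rewrite big_nil.
rewrite big_cons.
have [|T T0 fT] := mean_leD (fc i (mem_head _ _)) (IHs _).
  by move=> j js; apply: fc; rewrite in_cons js orbT.
exists T => // m; apply: le_trans (fT m).
by under eq_bigr do rewrite big_cons.
Qed.

Lemma mean_le_exists (R : realType) (q : nat) (f : int -> R) (c : R) :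
  mean_le q f c -> exists n, f n <= c.
Proof.
move=> [T T0 fT]; have := fT 0; rewrite -sum_seq_cst.
apply: contraPP => /forallNP fc; apply/negP; rewrite -ltNge.
have {}fc n : c < f n by rewrite ltNge; apply/negP/fc.
case: T T0 {fT} => // t T _; rewrite !big_cons ltr_leD//.
by apply: ler_sum => u _; exact/ltW/fc.
Qed.

Lemma cancels_mean_le (R : realType) (q : nat) (theta : int -> R) (eta : R) :
  cancels q theta eta -> mean_le q (fun n => ecos (theta n)) eta.
Proof.
move=> [T T0 thT]; exists T => // m; apply: le_trans (thT m 0).
by apply: ler_sum => t _; rewrite addr0.
Qed.

(** The van der Corput inequality: averaging first over [H], the square of the
inner average is a double sum of differenced phases, which the outer average
controls. *)
Lemma cancels_differencing (R : realType) (q : nat) (theta : int -> R)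
    (H : seq int) (eta : R) :
  0 < eta -> H != [::] ->
  mean_le q (fun n => \sum_(h <- H) \sum_(h' <- H)
                        ecos (theta (n + h *+ q) - theta (n + h' *+ q)))
    (((size H)%:R * eta) ^+ 2) ->
  cancels q theta eta.
Proof.
move=> eta0 H0 [T T0 FT].
exists [seq t + h | t <- T, h <- H].
  by rewrite -size_eq0 size_allpairs muln_eq0 !size_eq0 negb_or T0.
move=> m phi; rewrite size_allpairs big_allpairs_dep.
set c := (size H)%:R * eta in FT *.
have c0 : 0 < c by rewrite mulr_gt0// ltr0n lt0n size_eq0.
rewrite natrM -mulrA -/c -(ler_pM2l c0) -(ler_pM2l (ltr0Sn R 1)).
pose F n := \sum_(h <- H) \sum_(h' <- H)
                        ecos (theta (n + h *+ q) - theta (n + h' *+ q)).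
apply: (@le_trans _ _ (\sum_(t <- T) (c ^+ 2 + F (m + t *+ q)))).
  rewrite !mulr_sumr; apply: ler_sum => t _.
  set x := \sum_(h <- H) _.
  have le_F : x ^+ 2 <= F (m + t *+ q).
    apply: le_trans (sqr_sum_ecos_le _ _ _) _.
    by apply: ler_sum => h _; apply: ler_sum => h' _; rewrite !mulrnDl !addrA.
  (* Linearizing the square at c replaces the Cauchy-Schwarz inequality. *)
  have := sqr_ge0 (c - x); rewrite sqrrB; lra.
rewrite big_split /= sum_seq_cst.
by have := FT m; rewrite -/(F _); lra.
Qed.

(** * Weyl's inequality for the leading coefficient *)

Lemma size_exp_XaddC (R : nzRingType) (n : nat) (c : R) :
  size (('X + c%:P) ^+ n) = n.+1.
Proof. by rewrite -[c]opprK polyCN size_exp_XsubC. Qed.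

Lemma coef_exp_XaddC (R : nzRingType) (n : nat) (c : R) :
  (('X + c%:P) ^+ n)`_n = 1.
Proof.
have /monicP : ('X + c%:P) ^+ n \is monic by rewrite monic_exp// monicXaddC.
by rewrite lead_coefE size_exp_XaddC.
Qed.

Lemma coef_exp_XaddC_pred (R : nzRingType) (n : nat) (c : R) :
  (('X + c%:P) ^+ n.+1)`_n = c *+ n.+1.
Proof.
elim: n => [|n IHn]; first by rewrite coefD coefX coefC add0r.
by rewrite exprSr mulrDr coefD coefMX coefMC IHn coef_exp_XaddC mul1r -mulrSr.
Qed.

Lemma coef_comp_XaddC (R : comNzRingType) (P : {poly R}) (c : R) (n : nat) :
  (size P <= n.+2)%N ->
  (P \Po ('X + c%:P))`_n = P`_n + P`_n.+1 * (c *+ n.+1).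
Proof.
move=> sP; rewrite /comp_poly (@horner_coef_wide _ n.+2) ?size_map_polyC//.
rewrite coef_sum !big_ord_recr/= !coef_map/= !coefCM.
rewrite coef_exp_XaddC mulr1 coef_exp_XaddC_pred big1 ?add0r// => i _.
 by rewrite coef_map/= coefCM [X in _ * X]nth_default ?mulr0// size_exp_XaddC.
Qed.

(** Differencing lowers the degree by one and multiplies the leading coefficient
by the degree and the shift. *)
Lemma differencing_poly (R : comNzRingType) (P : {poly R}) (D : nat) (c c' : R) :
  (size P <= D.+2)%N ->
  let Q := (P \Po ('X + c%:P)) - (P \Po ('X + c'%:P)) in
  (size Q <= D.+1)%N /\ Q`_D = P`_D.+1 * ((c - c') *+ D.+1).
Proof.
move=> sP Q; split.
  apply/leq_sizeP => j Dj.
  have sPj : (size P <= j.+2)%N by rewrite (leq_trans sP)// !ltnS ltnW.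
  rewrite /Q coefB !coef_comp_XaddC//.
  by rewrite [P`_j.+1]nth_default ?(leq_trans sP)// !mul0r subrr.
by rewrite /Q coefB !coef_comp_XaddC// mulrnBl mulrBr opprD addrACA subrr add0r.
Qed.

Lemma cancels_linear (R : realType) (q : nat) (eta : R) (P : {poly R}) :
  0 < eta -> (size P <= 2)%N -> q%:R * P`_1 \isn't a Num.int ->
  cancels q (fun n => P.[n%:~R]) eta.
Proof.
move=> eta0 sP /sin_pi_neq0; set a := q%:R * P`_1; rewrite -normr_gt0 => s0.
set H := Num.bound (`|sin (pi * a)| * eta)^-1.
have H1 : 1 < `|sin (pi * a)| * eta * H%:R.
  rewrite -ltr_pdivrMl ?mulr_gt0// mulr1.
  by rewrite archi_boundP// invr_ge0 ltW// mulr_gt0.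
exists [seq Posz h | h <- iota 0 H].
  rewrite -size_eq0 size_map size_iota; apply: contraTneq H1 => ->.
  by rewrite mulr0 ltr10.
move=> m phi; rewrite size_map size_iota big_map -[iota 0 H]/(index_iota 0 H).
rewrite big_mkord -(ler_pM2l s0).
under eq_bigr => h _.
  rewrite (horner_coef_wide _ sP) !big_ord_recr big_ord0/= expr0 expr1 mulr1 add0r.
  rewrite rmorphD rmorphMn/= -pmulrn -mulr_natl.
  have -> : P`_0 + P`_1 * (m%:~R + q%:R * h%:R) + phi =
    a * h%:R + (P`_0 + P`_1 * m%:~R + phi) by rewrite /a; ring.
  over.
by apply: le_trans (sum_ecos_arith_le _ _ _) _; lra.
Qed.

(** [K`!] is a common multiple of all the shift differences that occur when
differencing along [0, ..., K - 1]. *)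
Lemma dvd_diff_fact (R : realType) (K h h' : nat) :
  h \in iota 0 K -> h' \in iota 0 K -> h != h' ->
  exists e : int, K`!%:R = e%:~R * (h%:R - h'%:R) :> R.
Proof.
rewrite !mem_iota add0n => /andP[_ hK] /andP[_ h'K].
have dvd a b : (a < b)%N -> (b < K)%N ->
    exists e : nat, K`!%:R = e%:R * (b%:R - a%:R) :> R.
  move=> ab bK; have /dvdnP[e ->] : (b - a %| K`!)%N.
    by rewrite dvdn_fact// subn_gt0 ab/= (leq_trans (leq_subr _ _))// ltnW.
  by exists e; rewrite natrM natrB// ltnW.
rewrite neq_ltn => /orP[/dvd/(_ h'K)|/dvd/(_ hK)] [e ->].
  by exists (- e%:Z); rewrite mulrNz -pmulrn mulNr -mulrN opprB.
by exists e%:Z.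
Qed.

(** Induction on the degree.  When [L] times the leading coefficient is not an
integer, with [L] divisible by [K`!] and by the constant of the lower degree, all
the polynomials obtained from two distinct shifts still satisfy the hypothesis
of the induction.  Only the [K] diagonal pairs out of [K ^ 2] do not cancel,
and [K] is large. *)
Lemma cancels_top (R : realType) (D q : nat) (eta : R) : (0 < q)%N -> 0 < eta ->
  exists2 L : nat, (0 < L)%N & forall P : {poly R}, (size P <= D.+2)%N ->
    L%:R * P`_D.+1 \isn't a Num.int -> cancels q (fun n => P.[n%:~R]) eta.
Proof.
move=> q0; elim: D eta => [|D IHD] eta eta0.
  by exists q => // P; exact: cancels_linear.
have [L L0 LP] := IHD (eta ^+ 2 / 2) ltac:(by rewrite divr_gt0// exprn_gt0).
have [K K1] : exists K : nat, 1 < eta ^+ 2 / 2 * K%:R.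
  exists (Num.bound (eta ^+ 2 / 2)^-1).
  rewrite -ltr_pdivrMl ?divr_gt0 ?exprn_gt0// mulr1.
  by rewrite archi_boundP// invr_ge0 divr_ge0// exprn_ge0// ltW.
exists (D.+2 * q * K`! * L)%N; first by rewrite !muln_gt0 q0 fact_gt0.
move=> P sP LPN.
apply: (@cancels_differencing _ _ _ [seq Posz h | h <- iota 0 K]) => //.
  rewrite -size_eq0 size_map size_iota; apply: contraTneq K1 => ->.
  by rewrite mulr0 ltr10.
pose Q (h h' : nat) := (P \Po ('X + (h * q)%:R%:P)) - (P \Po ('X + (h' * q)%:R%:P)).
suff : mean_le q (fun n => \sum_(h <- iota 0 K) \sum_(h' <- iota 0 K)
     ecos (Q h h').[n%:~R]) (\sum_(h <- iota 0 K) \sum_(h' <- iota 0 K)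
       ((h == h')%:R + eta ^+ 2 / 2)).
  apply: mean_leW => [n|].
    rewrite big_map; apply: ler_sum => h _; rewrite big_map; apply: ler_sum => h' _.
    rewrite /Q hornerD hornerN !horner_comp !hornerD !hornerX !hornerC.
    by rewrite !rmorphD !rmorphMn/= -!pmulrn !natrM !mulr_natr.
  rewrite size_map size_iota exprMn.
  under eq_bigr => h hK.
    rewrite big_split/= sum_seq_cst size_iota.
    over.
  rewrite big_split/= sum_seq_cst size_iota.
  have -> : \sum_(h <- iota 0 K) \sum_(h' <- iota 0 K) ((h == h')%:R : R) = K%:R.
    rewrite -[RHS]mulr1 -[X in _ = X%:R * _](size_iota 0) -sum_seq_cst.
    rewrite big_seq [RHS]big_seq; apply: eq_bigr => h hK.
    rewrite (bigD1_seq h) ?iota_uniq//= eqxx big1 ?addr0// => h'.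
    by rewrite eq_sym => /negPf ->.
  have K0 : 0 <= K%:R :> R by [].
  nra.
apply: mean_le_sum => h hK; apply: mean_le_sum => h' hK'.
have [<-|hh'] := eqVneq h h'.
  apply: mean_le_cst => n; rewrite (le_trans (ecos_le1 _))//.
  by rewrite lerDl divr_ge0// exprn_ge0// ltW.
rewrite add0r; apply: cancels_mean_le.
have [sQ QD] := differencing_poly (h * q)%:R (h' * q)%:R sP.
apply: LP => //; apply: contra LPN => LQ.
have [e eE] := dvd_diff_fact R hK hK' hh'.
suff -> : (D.+2 * q * K`! * L)%:R * P`_D.+2 = e%:~R * (L%:R * (Q h h')`_D.+1).
  by rewrite rpredM// intr_int.
by rewrite QD !natrM eE -[_ *+ D.+2]mulr_natr; ring.
Qed.

(** * Weyl's inequality for all coefficients *)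

(** Coefficients are treated from the top.  Once [L] times the leading
coefficient is an integer, the leading monomial is constant modulo 1 along a
progression of step [L * q], so it is absorbed by the free phase and the lower
part can be averaged along that progression. *)
Lemma cancels_poly (R : realType) (D q : nat) (eta : R) : (0 < q)%N -> 0 < eta ->
  exists2 L : nat, (0 < L)%N & forall P : {poly R}, (size P <= D.+1)%N ->
    (forall j, (0 < j)%N -> L%:R * P`_j \is a Num.int) \/
    cancels q (fun n => P.[n%:~R]) eta.
Proof.
move=> q0 eta0; elim: D q q0 => [|D IHD] q q0.
  exists 1%N => // P sP; left=> j j0.
  by rewrite nth_default ?mulr0// (leq_trans sP).
have [L L0 LP] := cancels_top D q0 eta0.
have [L' L'0 L'P] := IHD (L * q)%N ltac:(by rewrite muln_gt0 L0).
exists (L * L')%N => [|P sP]; first by rewrite muln_gt0 L0.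
have [LPint|/LP] := boolP (L%:R * P`_D.+1 \is a Num.int); last by right; auto.
pose P' := take_poly D.+1 P.
have [P'int|[T T0 P'T]] := L'P P' (size_take_poly _ _); [left|right].
  move=> j j0; rewrite natrM; have [jD|] := ltnP j D.+1.
    have := P'int j j0; rewrite coef_take_poly jD => Pj.
    by rewrite -mulrA rpredM ?natr_int.
  rewrite leq_eqVlt => /predU1P[<-|jD]; first by rewrite mulrAC rpredM ?natr_int.
  by rewrite nth_default ?mulr0// (leq_trans sP).
have PE x : P.[x] = P'.[x] + P`_D.+1 * x ^+ D.+1.
  rewrite (horner_coef_wide _ sP) big_ord_recr/=; congr (_ + _).
  rewrite (horner_coef_wide _ (size_take_poly _ _)); apply: eq_bigr => i _.
  by rewrite coef_take_poly ltn_ord.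
exists [seq t *+ L | t <- T] => [|m phi]; first by case: T T0 {P'T}.
rewrite size_map big_map.
apply: le_trans (P'T m (P`_D.+1 * m%:~R ^+ D.+1 + phi)).
apply: ler_sum => t _; rewrite -mulrnA.
have [z zE] : exists z : int, (m + t *+ (L * q)) ^+ D.+1 = m ^+ D.+1 + t *+ (L * q) * z.
  exists (\sum_(i < D.+1) (m + t *+ (L * q)) ^+ (D.+1.-1 - i) * m ^+ i).
  by apply/eqP; rewrite [eqbRHS]addrC -subr_eq subrXX addrAC subrr add0r.
have /intrP[w wE] : P`_D.+1 * (t *+ (L * q) * z)%:~R \is a Num.int.
  rewrite intrM rmorphMn/= -mulr_natr natrM.
  rewrite (_ : _ * _ = L%:R * P`_D.+1 * (t%:~R * q%:R * z%:~R)); last by ring.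
  by rewrite rpredM// !rpredM ?intr_int ?natr_int.
rewrite PE -rmorphXn/= zE [(m ^+ _ + _)%:~R]intrD mulrDr wE rmorphXn/=.
rewrite (_ : _ + _ + phi = P'.[(m + t *+ (L * q))%:~R] +
  (P`_D.+1 * m%:~R ^+ D.+1 + phi) + w%:~R); last by ring.
by rewrite ecosDz.
Qed.

(** * A trigonometric polynomial concentrated near the origin *)

Lemma int_dotDl (R : nzRingType) (d : nat) (v w : 'cV[int]_d) (x : 'cV[R]_d) :
  int_dot (v + w) x = int_dot v x + int_dot w x.
Proof.
by rewrite /int_dot -big_split; apply: eq_bigr => i _; rewrite mxE intrD mulrDl.
Qed.

Lemma int_dotNl (R : nzRingType) (d : nat) (v : 'cV[int]_d) (x : 'cV[R]_d) :
  int_dot (- v) x = - int_dot v x.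
Proof.
by rewrite /int_dot -sumrN; apply: eq_bigr => i _; rewrite mxE mulrNz mulNr.
Qed.

Lemma int_dotBr (R : nzRingType) (d : nat) (v : 'cV[int]_d) (x y : 'cV[R]_d) :
  int_dot v (x - y) = int_dot v x - int_dot v y.
Proof.
by rewrite /int_dot -sumrB; apply: eq_bigr => i _; rewrite !mxE mulrBr.
Qed.

Lemma int_dot_delta (R : nzRingType) (d : nat) (j : 'I_d) (x : 'cV[R]_d) :
  int_dot (delta_mx j 0) x = x j 0.
Proof.
rewrite /int_dot (bigD1 j)//= big1 ?addr0 => [|i /negPf ij].
  by rewrite mxE !eqxx mul1r.
by rewrite mxE ij mul0r.
Qed.

(** The exponents, with multiplicity, in the expansion of the product of the
[1 + z_j] over [j] in [js]; the squared modulus of this product on the torus is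
the kernel evaluated in [sum_cube_sums]. *)
Definition cube_sums {d : nat} (js : seq 'I_d) : seq 'cV[int]_d :=
  foldr (fun j W => [seq a + b | a <- [:: 0; delta_mx j 0], b <- W]) [:: 0] js.

Lemma cube_sums_cons (d : nat) (j : 'I_d) (js : seq 'I_d) :
  cube_sums (j :: js) =
  [seq a + b | a <- [:: 0; delta_mx j 0], b <- cube_sums js].
Proof. by []. Qed.

Lemma size_cube_sums (d : nat) (js : seq 'I_d) :
  size (cube_sums js) = (2 ^ size js)%N.
Proof. by elim: js => // j js IHjs; rewrite cube_sums_cons size_allpairs IHjs expnS. Qed.

Lemma mem_cube_sums (d : nat) (js : seq 'I_d) (a : 'cV[int]_d) (i : 'I_d) :
  a \in cube_sums js -> 0 <= a i 0 <= (count_mem i js)%:Z.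
Proof.
elim: js a => [|j js IHjs] a; first by rewrite inE => /eqP ->; rewrite mxE.
rewrite cube_sums_cons => /allpairsP[[e b] /= [eE /IHjs/andP[b0 bjs] ->]]; rewrite mxE PoszD.
suff /andP[e0 ej] : 0 <= e i 0 <= (j == i)%:Z by rewrite addr_ge0// lerD.
move: eE; rewrite !inE => /orP[] /eqP ->; rewrite mxE// ?eqxx ?andbT.
by rewrite eq_sym; case: eqP.
Qed.

(** Each step of the induction multiplies by [|1 + z_j| ^ 2 = 2 + 2 cos].  The
free phase [phi] is what makes the four terms of one step recombine. *)
Lemma sum_cube_sums (R : realType) (d : nat) (js : seq 'I_d) (x : 'cV[R]_d) (phi : R) :
  \sum_(a <- cube_sums js) \sum_(b <- cube_sums js) ecos (int_dot (a - b) x + phi) =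
  (size (cube_sums js))%:R ^+ 2 * \prod_(j <- js) ((1 + ecos (x j 0)) / 2) * ecos phi.
Proof.
elim: js phi => [|j js IHjs] phi.
  rewrite !big_seq1 big_nil subrr /int_dot big1 => [|i _]; last by rewrite mxE mul0r.
  by rewrite add0r expr1n !mul1r.
rewrite cube_sums_cons; set W := cube_sums js in IHjs *.
have -> : \sum_(a <- [seq a + b | a <- [:: 0; delta_mx j 0], b <- W])
    \sum_(b <- [seq a + b | a <- [:: 0; delta_mx j 0], b <- W])
      ecos (int_dot (a - b) x + phi) =
    \sum_(e <- [:: 0; delta_mx j 0]) \sum_(f <- [:: 0; delta_mx j 0])
    \sum_(a <- W) \sum_(b <- W) ecos (int_dot (a - b) x + (int_dot (e - f) x + phi)).
  rewrite big_allpairs_dep; apply: eq_bigr => e _.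
  rewrite [RHS]exchange_big; apply: eq_bigr => a _.
  rewrite big_allpairs_dep; apply: eq_bigr => f _; apply: eq_bigr => b _.
  by rewrite opprD addrACA [e - f + _]addrC (int_dotDl (a - b)) addrA.
rewrite !big_cons !big_nil !addr0 !IHjs !subrr sub0r subr0 int_dotNl int_dot_delta.
have -> : int_dot 0 x = 0 by rewrite /int_dot big1// => i _; rewrite mxE mul0r.
rewrite size_allpairs -/W natrM/= !add0r [x j 0 + _]addrC [- x j 0 + _]addrC.
have := ecosDB phi (x j 0); move: (ecos (phi + _)) (ecos (phi - _)) => u v uv.
have -> : u = 2 * ecos phi * ecos (x j 0) - v by rewrite -uv addrK.
by field.
Qed.

(** Cauchy-Schwarz applied to the multiplicities of the elements of [W]. *)
Lemma sqr_size_le_collisions (R : realType) (T : eqType) (W B : seq T) :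
  {subset W <= B} ->
  (size W)%:R ^+ 2 <= (size B)%:R * \sum_(a <- W) \sum_(b <- W) (a == b)%:R :> R.
Proof.
move=> WB.
pose n (c : T) : R := (count_mem c W)%:R.
have nE c : n c = \sum_(a <- W) (a == c)%:R.
  by rewrite /n -sum1_count natr_sum [LHS]big_mkcond; apply: eq_bigr => a _ /=; case: eqP.
have B0 : undup B = [::] -> W = [::].
  case: W WB {n nE} => // a W WB B0.
  by have := WB a (mem_head _ _); rewrite -mem_undup B0.
have sumn : \sum_(c <- undup B) n c = (size W)%:R.
  under eq_bigr do rewrite nE.
  rewrite exchange_big -[RHS]mulr1 -sum_seq_cst big_seq [RHS]big_seq.
  apply: eq_bigr => a aW /=; rewrite (bigD1_seq a) ?undup_uniq ?mem_undup ?WB//=.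
  by rewrite eqxx big1 ?addr0// => c; rewrite eq_sym => /negPf ->.
have sumn2 : \sum_(c <- undup B) n c ^+ 2 = \sum_(a <- W) \sum_(b <- W) (a == b)%:R.
  under eq_bigr do rewrite expr2 {1}nE mulr_suml.
  rewrite exchange_big big_seq [RHS]big_seq.
  apply: eq_bigr => a aW /=; rewrite (bigD1_seq a) ?undup_uniq ?mem_undup ?WB//=.
  rewrite eqxx mul1r [X in _ + X]big1 ?addr0 => [|c]; last first.
    by rewrite eq_sym => /negPf ->; rewrite mul0r.
  by rewrite nE; apply: eq_bigr => b _; rewrite eq_sym.
have M0 : (size (undup B))%:R <= (size B)%:R :> R by rewrite ler_nat size_undup.
rewrite -sumn2.
have sum0 : 0 <= \sum_(c <- undup B) n c ^+ 2 by apply: sumr_ge0 => c _; exact: sqr_ge0.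
apply: le_trans (ler_wpM2r sum0 M0).
have [M0'|M0'] := posnP (size (undup B)).
  by rewrite M0' mul0r B0 ?expr0n//; apply/eqP; rewrite -size_eq0 M0'.
set M : R := (size (undup B))%:R; set w : R := (size W)%:R.
rewrite -(ler_pM2l (_ : 0 < M)) ?ltr0n// -subr_ge0.
rewrite (_ : _ - _ = \sum_(c <- undup B) (M * n c - w) ^+ 2).
  by apply: sumr_ge0 => c _; exact: sqr_ge0.
transitivity (M ^+ 2 * (\sum_(c <- undup B) n c ^+ 2) -
    (2 * M * w) * (\sum_(c <- undup B) n c) + M * w ^+ 2).
  by rewrite sumn -/w; ring.
rewrite -[M * _]sum_seq_cst !mulr_sumr -sumrB -big_split.
by apply: eq_bigr => c _ /=; ring.
Qed.

(** The frequency zero carries at least the proportion [p.+1 ^- d] of the kernel,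
because all the exponents lie in a box with [p.+1 ^ d] points. *)
Lemma collisions_cube_sums (R : realType) (d : nat) (js : seq 'I_d) (p : nat) :
  (forall i, count_mem i js <= p)%N ->
  (size (cube_sums js))%:R ^+ 2 <= p.+1%:R ^+ d *
    \sum_(a <- cube_sums js) \sum_(b <- cube_sums js) (a == b)%:R :> R.
Proof.
move=> jsp.
pose emb (c : 'cV['I_p.+1]_d) : 'cV[int]_d := map_mx (fun k : 'I_p.+1 => Posz k) c.
pose B := [seq emb c | c : 'cV['I_p.+1]_d].
have sB : size B = (p.+1 ^ d)%N by rewrite size_map -cardE card_mx card_ord muln1.
rewrite -[_ ^+ d]natrX -sB; apply: sqr_size_le_collisions => a aW.
apply/mapP; exists (map_mx (fun z : int => inord `|z|%N) a); first by rewrite mem_enum.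
apply/matrixP => i j; rewrite ord1 !mxE.
have /andP[a0 ap] := mem_cube_sums i aW.
rewrite inordK ?gez0_abs// ltnS -lez_nat gez0_abs//.
by rewrite (le_trans ap)// lez_nat jsp.
Qed.

(** Comparing a geometric sum with its smallest term gives [rho ^+ r = O(1/r)].
The square of this bound beats one linear factor, and the power [d] of the
result handles [p = 2 r d]. *)
Lemma geometric_beats_poly (R : realType) (rho : R) (d : nat) :
  0 <= rho < 1 -> (0 < d)%N -> exists p : nat, rho ^+ p * p.+1%:R ^+ d < 1.
Proof.
move=> /andP[rho0 rho1] d0.
have rho_pow (r : nat) : r%:R * (1 - rho) * rho ^+ r <= 1.
  have : 1 - rho ^+ r <= 1 by rewrite lerBlDr lerDl exprn_ge0.
  apply: le_trans; rewrite -[1 - _ ^+ r]opprB subrX1 -mulNr opprB mulrAC mulrC.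
  rewrite ler_wpM2l//; first by rewrite subr_ge0 ltW.
  rewrite mulr_natl.
  rewrite (_ : _ *+ r = \sum_(i < r) rho ^+ r); last by rewrite sumr_const card_ord.
  apply: ler_sum => i _.
  by apply: ler_wiXn2l => //; [exact: ltW|exact: ltnW].
have [r r1 rP] : exists2 r : nat, 1 <= r%:R :> R & 4 * d.+1%:R < r%:R * (1 - rho) ^+ 2.
  exists (Num.bound ((4 * d.+1%:R) / (1 - rho) ^+ 2)).+1; first by rewrite ler1n.
  rewrite -ltr_pdivrMr ?exprn_gt0 ?subr_gt0//.
  apply: lt_trans (archi_boundP _) _; last by rewrite ltr_nat.
  by rewrite divr_ge0// sqr_ge0.
exists (2 * r * d)%N; rewrite exprM -exprMn exprn_ilt1 -?lt0n ?d0//.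
  by rewrite mulr_ge0 ?exprn_ge0.
have x0 : 0 <= rho ^+ r ^+ 2 by rewrite exprn_ge0// exprn_ge0.
have : (r%:R * (1 - rho) * rho ^+ r) ^+ 2 <= 1.
  apply: exprn_ile1 (rho_pow r).
  by rewrite !mulr_ge0 ?exprn_ge0// subr_ge0 ltW.
rewrite mulnC exprM mulrSr !natrM exprMn; move: (rho ^+ r ^+ 2) x0 => x x0 rx.
rewrite -[d.+1%:R]natr1 in rP.
have : x * (2 * (r%:R * 2 * d%:R + 1)) <= x * (r%:R * (1 - rho)) ^+ 2.
  rewrite ler_wpM2l//.
  have : r%:R * (4 * (d%:R + 1)) <= r%:R * (r%:R * (1 - rho) ^+ 2).
    by rewrite ler_wpM2l// ltW.
  lra.
lra.
Qed.

(** Take the [p]-th power of the kernel of all the coordinates.  It is at most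
[rho ^ p] where one coordinate is far from the integers, while its mean is at
least [p.+1 ^- d], which is larger for a suitable [p]; so its nonconstant part is
bounded away from zero, on the negative side, at every such point. *)
Lemma fourier_obstruction (R : realType) (d : nat) (eps : R) :
  (0 < d)%N -> ecos eps < 1 ->
  exists V : seq 'cV[int]_d, exists2 c : R, 0 < c &
    (forall v, v \in V -> v != 0) /\
    forall x : 'cV[R]_d, (exists j, ecos (x j 0) <= ecos eps) ->
      \sum_(v <- V) ecos (int_dot v x) <= - c.
Proof.
move=> d0 eps1.
have ecosN1 (x : R) : -1 <= ecos x by exact: cos_geN1.
pose rho := (1 + ecos eps) / 2.
have rho01 : 0 <= rho < 1.
  by rewrite /rho; have := ecosN1 eps; move: eps1; lra.
have [p pP] := geometric_beats_poly rho01 d0.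
pose js : seq 'I_d := flatten (nseq p (enum 'I_d)).
have js_count i : count_mem i js = p.
  rewrite /js count_flatten map_nseq sumn_nseq count_uniq_mem ?enum_uniq//.
  by rewrite mem_enum mul1n.
have prod_le x : (exists j, ecos (x j 0) <= ecos eps) ->
    \prod_(j <- js) ((1 + ecos (x j 0)) / 2) <= rho ^+ p :> R.
  move=> [j xj]; rewrite /js big_flatten big_nseq iter_mulr_1 big_enum/=.
  have f01 i : 0 <= (1 + ecos (x i 0)) / 2 <= 1.
    by have := ecosN1 (x i 0); have := ecos_le1 (x i 0); lra.
  have prod0 (P : pred 'I_d) : 0 <= \prod_(i | P i) ((1 + ecos (x i 0)) / 2) <= 1.
    apply/andP; split; first by apply: prodr_ge0 => i _; case/andP: (f01 i).
    by apply: prodr_ile1 => i _; exact: f01.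
  rewrite lerXn2r ?nnegrE//; first by case/andP: (prod0 predT).
    by case/andP: rho01.
  rewrite (bigD1 j)//= -[leRHS]mulr1 ler_pM//; first by case/andP: (f01 j).
  - by case/andP: (prod0 (fun i => i != j)).
  - by rewrite /rho; lra.
  - by case/andP: (prod0 (fun i => i != j)).
set W := cube_sums js; set w : R := (size W)%:R.
have w0 : 0 < w by rewrite ltr0n size_cube_sums expn_gt0.
have coll := collisions_cube_sums R (fun i => eq_leq (js_count i)).
pose V := [seq ab.1 - ab.2 | ab <- [seq (a, b) | a <- W, b <- W] & ab.1 != ab.2].
exists V, (w ^+ 2 * (p.+1%:R ^- d - rho ^+ p)).
  rewrite mulr_gt0 ?exprn_gt0// subr_gt0 -[ltRHS]mul1r ltr_pdivlMr//.
split=> [v /mapP[ab]|x /prod_le xP].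
  by rewrite mem_filter => /andP[ab0 _] ->; rewrite subr_eq0.
have := sum_cube_sums js x 0; rewrite -/W -/w ecos0 mulr1 => sumW.
have : \sum_(a <- W) \sum_(b <- W) ecos (int_dot (a - b) x + 0) =
  \sum_(a <- W) \sum_(b <- W) (a == b)%:R + \sum_(v <- V) ecos (int_dot v x).
  rewrite /V big_map big_filter [X in _ + X]big_mkcond big_allpairs -big_split.
  apply: eq_bigr => a _; rewrite -big_split; apply: eq_bigr => b _ /=.
  rewrite addr0; case: eqP => [->|_]; last by rewrite add0r.
  rewrite addr0 subrr /int_dot big1 ?ecos0// => i _.
  by rewrite mxE mul0r.
have : w ^+ 2 / p.+1%:R ^+ d <= \sum_(a <- W) \sum_(b <- W) (a == b)%:R.
  by rewrite ler_pdivrMr ?exprn_gt0// mulrC.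
have : w ^+ 2 * \prod_(j <- js) ((1 + ecos (x j 0)) / 2) <= w ^+ 2 * rho ^+ p.
  by rewrite ler_wpM2l ?sqr_ge0.
rewrite sumW mulrBr; lra.
Qed.

(** * From a missed ball to a large exponential sum *)

Lemma half_turn_itv (R : realType) (x : R) :
  0 <= x <= 2^-1 -> pi *+ 2 * x \in `[0, pi].
Proof.
move=> /andP[x0 x2]; have pi0 := pi_gt0 R.
rewrite in_itv/=; apply/andP; split.
  by rewrite mulr_ge0// mulrn_wge0// ltW.
by rewrite -mulr_natr -mulrA ger_pMr//; lra.
Qed.

Lemma ecos_lt1 (R : realType) (eps : R) : 0 < eps <= 2^-1 -> ecos eps < 1.
Proof.
move=> /andP[eps0 eps2]; have pi0 := pi_gt0 R.
have eps02 : 0 <= eps <= 2^-1 by rewrite ltW.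
have zero02 : 0 <= (0 : R) <= 2^-1 by apply/andP; split; lra.
rewrite -(@ecos0 R) /ecos ltr_cos ?half_turn_itv//.
by rewrite mulr0 mulr_gt0// mulrn_wgt0.
Qed.

(** Rounding every coordinate to a nearest integer gives a representative; if all
its coordinates were small, the norm would be small too. *)
Lemma torus_norm_gt_coord (R : realType) (d : nat) (eps : R) (x : 'cV[R]_d) :
  0 < eps <= 2^-1 -> eps < torus_norm (torus_proj x) ->
  exists j, ecos (x j 0) <= ecos eps.
Proof.
move=> /andP[eps0 eps2]; have pi0 := pi_gt0 R.
have [z zx [-> zmin]] := torus_norm_min (torus_proj x) => epsz.
pose m i := Num.floor (x i 0 + 2^-1).
pose y : 'cV[R]_d := \col_i (x i 0 - (m i)%:~R).
have yx : torus_proj y = torus_proj x.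
  apply/torus_projP/mxOverP => i j; rewrite !mxE ord1 addrAC subrr add0r.
  by rewrite rpredN intr_int.
have {zmin} epsy := lt_le_trans epsz (zmin y yx).
have [j yj] : exists j, eps < `|y j 0|.
  apply/existsP; apply: contraTT epsy; rewrite negb_exists -leNgt => /forallP yle.
  rewrite [leLHS]/Num.Def.normr /= mx_normrE.
  apply: bigmax_le => [|[i j] _ /=]; first exact: ltW.
  by rewrite ord1 leNgt.
exists j; have -> : ecos (x j 0) = cos (pi *+ 2 * `|y j 0|).
  rewrite -[x j 0](subrK (m j)%:~R) ecosDz /ecos -cos_norm normrM mxE.
  by rewrite [`|pi *+ 2|]ger0_norm// mulrn_wge0// ltW.
have y2 : `|y j 0| <= 2^-1.
  rewrite mxE ler_norml.
  have := floor_le (x j 0 + 2^-1); have := floorD1_gt (x j 0 + 2^-1).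
  by rewrite -/(m j) intrD; lra.
have eps02 : 0 <= eps <= 2^-1 by rewrite ltW.
have yj02 : 0 <= `|y j 0| <= 2^-1 by rewrite normr_ge0.
rewrite ltW// ltr_cos ?half_turn_itv//.
by rewrite ltr_pM2l// mulrn_wgt0.
Qed.

(** Summing the obstruction over the points forces the real parts of the
exponential sums to be at most [- size s * c] in total; this passes to the
squared moduli, which do not change when all the [u i] are translated
together. *)
Lemma fourier_energy (R : realType) (d : nat) (I : eqType) (s : seq I)
    (V : seq 'cV[int]_d) (c : R) (u : I -> 'cV[R]_d) :
  {in s, forall i, \sum_(v <- V) ecos (int_dot v (u i)) <= - c} -> 0 < c ->
  ((size s)%:R * c) ^+ 2 / (size V).+1%:R <=
  \sum_(v <- V) \sum_(i <- s) \sum_(j <- s) ecos (int_dot v (u i - u j)).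
Proof.
move=> uc c0; set k : R := (size s)%:R; set n : R := (size V).+1%:R.
pose X v := \sum_(i <- s) ecos (int_dot v (u i)).
have XV : \sum_(v <- V) X v <= - (k * c).
  rewrite exchange_big -mulrN -sum_seq_cst big_seq [leRHS]big_seq.
  exact: ler_sum.
pose E v := \sum_(i <- s) \sum_(j <- s) ecos (int_dot v (u i - u j)).
have XE v : X v ^+ 2 <= E v.
  have := sqr_sum_ecos_le s (fun i => int_dot v (u i)) 0.
  under eq_bigr do rewrite addr0.
  move=> /le_trans; apply; apply: ler_sum => i _; apply: ler_sum => j _.
  by rewrite int_dotBr.
have n0 : 0 < n by rewrite ltr0n.
(* The tangent inequality - 2 t X <= t ^ 2 + X ^ 2 replaces Cauchy-Schwarz; the
   successor in n keeps the division harmless if V is empty. *)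
pose t := k * c / n.
have : \sum_(v <- V) (- (2 * t) * X v) <= \sum_(v <- V) (t ^+ 2 + E v).
  apply: ler_sum => v _; apply: le_trans (lerD (lexx _) (XE v)).
  have := sqr_ge0 (t + X v); rewrite sqrrD; lra.
rewrite -mulr_sumr big_split/= sum_seq_cst => XVE.
have t0 : 0 <= t by rewrite /t divr_ge0 ?mulr_ge0// ltW.
have tX : 2 * t * (k * c) <= - (2 * t) * \sum_(v <- V) X v.
  by have := ler_wpM2l (mulr_ge0 (ler0n R 2) t0) XV; lra.
have nE : (size V)%:R = n - 1 :> R by rewrite /n -natr1 addrK.
rewrite nE in XVE.
have -> : (k * c) ^+ 2 / n = t * (k * c) by rewrite /t; field; rewrite gt_eqF.
have tn : t ^+ 2 * n = t * (k * c) by rewrite /t; field; rewrite gt_eqF.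
have := sqr_ge0 t; move: XVE tX tn; rewrite -/(\sum_(v <- V) E v); lra.
Qed.

(** * Phases with almost integral coefficients are rare *)

Definition phase {R : realType} {d : nat} (A : 'M[{poly int}]_d)
    (v : 'cV[int]_d) (w : 'cV[R]_d) : {poly R} := int_dot v (mulmx_poly A w).

Lemma coef_phase (R : realType) (d : nat) (A : 'M[{poly int}]_d)
    (v : 'cV[int]_d) (w : 'cV[R]_d) (l : nat) :
  (phase A v w)`_l = \sum_r (v r 0)%:~R * \sum_m ((A r m)`_l)%:~R * w m 0.
Proof.
rewrite /phase /int_dot coef_sum; apply: eq_bigr => r _.
rewrite mulrzl coefMrz mulrzl; congr (_ *~ _).
rewrite mxE coef_sum; apply: eq_bigr => m _.
by rewrite !mxE coefMC coef_map.
Qed.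

Lemma phaseB (R : realType) (d : nat) (A : 'M[{poly int}]_d)
    (v : 'cV[int]_d) (w w' : 'cV[R]_d) :
  phase A v (w - w') = phase A v w - phase A v w'.
Proof.
apply/polyP => l; rewrite coefB !coef_phase -sumrB; apply: eq_bigr => r _.
rewrite -mulrBr -sumrB; congr (_ * _); apply: eq_bigr => m _.
by rewrite !mxE mulrBr.
Qed.

Lemma horner_phase (R : realType) (d : nat) (A : 'M[{poly int}]_d)
    (v : 'cV[int]_d) (w : 'cV[R]_d) (n : int) :
  (phase A v w).[n%:~R] = int_dot v (map_mx intr (eval_mx A n) *m w).
Proof.
rewrite /phase /int_dot horner_sum; apply: eq_bigr => r _.
rewrite mulrzl hornerMz mulrzl; congr (_ *~ _).
rewrite !mxE horner_sum; apply: eq_bigr => m _.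
by rewrite !mxE hornerM hornerC horner_map.
Qed.

Lemma coef_phase_sub0 (R : realType) (d : nat) (A : 'M[{poly int}]_d)
    (v : 'cV[int]_d) (w : 'cV[R]_d) (l : nat) :
  (phase (A - map_mx polyC (eval_mx A 0)) v w)`_l =
  if l == 0%N then 0 else (phase A v w)`_l.
Proof.
rewrite !coef_phase; case: l => [|l] /=.
  rewrite big1// => r _; rewrite big1 ?mulr0// => m _.
  by rewrite !mxE coefB coefC/= horner_coef0 subrr mul0r.
apply: eq_bigr => r _; congr (_ * _); apply: eq_bigr => m _.
by rewrite !mxE coefB coefC/= subr0.
Qed.

Lemma size_phase (R : realType) (d : nat) (A : 'M[{poly int}]_d) (D : nat)
    (v : 'cV[int]_d) (w : 'cV[R]_d) :
  (forall r m, (size (A r m) <= D)%N) -> (size (phase A v w) <= D)%N.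
Proof.
move=> AD; apply/leq_sizeP => l Dl; rewrite coef_phase big1// => r _.
rewrite big1 ?mulr0// => m _.
by rewrite nth_default ?mul0r// (leq_trans (AD r m)).
Qed.

(** Bounds the coefficients of a phase uniformly over the differences of points
of the unit cube, see [coef_phase_le]. *)
Definition phase_height {d : nat} (A : 'M[{poly int}]_d) (v : 'cV[int]_d) (l : nat) : nat :=
  (\sum_r `|v r 0%R| * \sum_m `|((A r m)`_l)%R|)%N.

Lemma coef_phase_le (R : realType) (d : nat) (A : 'M[{poly int}]_d)
    (v : 'cV[int]_d) (w : 'cV[R]_d) (l : nat) :
  (forall m, `|w m 0| <= 1) -> `|(phase A v w)`_l| <= (phase_height A v l)%:R.
Proof.
move=> w1; rewrite coef_phase /phase_height natr_sum.
apply: le_trans (ler_norm_sum _ _ _) _; apply: ler_sum => r _.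
rewrite normrM natrM -intr_norm natr_absz ler_wpM2l// natr_sum.
apply: le_trans (ler_norm_sum _ _ _) _; apply: ler_sum => m _.
by rewrite normrM natr_absz -intr_norm ler_piMr.
Qed.

(** The exceptional case of [cancels_poly], read on the coefficients of degree
[1, ..., D]. *)
Definition near_integral {R : realType} {d : nat} (A : 'M[{poly int}]_d) (D L : nat)
    (v : 'cV[int]_d) (w : 'cV[R]_d) : bool :=
  [forall l : 'I_D, L%:R * (phase A v w)`_l.+1 \is a Num.int].

(** The exceptional points are coded by the integers [L] times the [l]-th
coefficient of the phase, for [1 <= l <= D].  These are bounded by [M] in
absolute value, and the code is injective because the nonconstant coefficients
separate the points. *)
Lemma count_near_integral (R : realType) (d : nat) (A : 'M[{poly int}]_d) (D L : nat)
    (v : 'cV[int]_d) (w0 : 'cV[R]_d) (s : seq 'cV[R]_d) :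
  (0 < L)%N ->
  (forall r m, (size (A r m) <= D.+1)%N) -> uniq s ->
  {in s, forall w m, `|(w - w0) m 0| <= 1} ->
  {in s &, forall w w', w != w' ->
    phase (A - map_mx polyC (eval_mx A 0)) v (w - w') != 0} ->
  (count (fun w => near_integral A D L v (w - w0)) s <=
   (2 * (L * \sum_(l < D) phase_height A v l.+1)).+1 ^ D)%N.
Proof.
move=> L0 AD s_uniq sw0 s_neq.
set M := (L * \sum_(l < D) phase_height A v l.+1)%N.
rewrite -size_filter; set bad := [seq w <- s | _].
pose t w (l : 'I_D) := L%:R * (phase A v (w - w0))`_l.+1.
pose code (w : 'cV[R]_d) : {ffun 'I_D -> 'I_(2 * M).+1} :=
  [ffun l : 'I_D => inord `|(Num.floor (t w l) + M%:Z)%R|%N].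
have codeE w l : w \in bad -> t w l = ((code w l : nat)%:Z - M%:Z)%:~R.
  rewrite mem_filter => /andP[/forallP/(_ l) w_int ws].
  have /floorK tK := w_int; rewrite -/(t w l) in tK.
  have /ler_normlP[tlow tup] : `|Num.floor (t w l)| <= M.
    rewrite -(ler_int R) intr_norm tK normrM ger0_norm// -pmulrn natrM.
    rewrite ler_wpM2l// (le_trans (coef_phase_le _ _ _ (sw0 w ws)))// ler_nat.
    by rewrite (bigD1 l)//= leq_addr.
  rewrite ffunE inordK; last by lia.
  by rewrite gez0_abs; [rewrite addrK tK | lia].
have code_inj : {in bad &, injective code}.
  move=> w w' wb w'b cww'; apply/eqP; apply: contraT => ww'.
  have ws : w \in s by move: wb; rewrite mem_filter => /andP[].
  have w's : w' \in s by move: w'b; rewrite mem_filter => /andP[].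
  have := s_neq _ _ ws w's ww'; rewrite (_ : w - w' = (w - w0) - (w' - w0)); last first.
    by rewrite opprB addrA subrK.
  move=> /negP[]; apply/eqP/polyP => l; rewrite coef_phase_sub0 coef0 phaseB coefB.
  case: l => [//|l] /=; have [lD|Dl] := ltnP l D; last first.
    by rewrite !nth_default ?subr0// (leq_trans (size_phase _ _ AD)).
  have L1 : L%:R != 0 :> R by rewrite pnatr_eq0 -lt0n.
  apply: (mulfI L1); rewrite mulr0 mulrBr.
  have := codeE w (Ordinal lD) wb; have := codeE w' (Ordinal lD) w'b.
  by rewrite /t /= cww' => -> ->; rewrite subrr.
rewrite -(size_map code) (leq_trans (uniq_leq_size _ (fun c _ => mem_enum predT c)))//.
  by rewrite map_inj_in_uniq ?filter_uniq.
by rewrite -cardE card_ffun !card_ord.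
Qed.

(** * Density of a dilate *)

Lemma card_ge_uniq_seq (T : pointedType) (k : nat) (Y : set T) :
  (`I_k #<= Y)%card -> exists s : seq T, [/\ uniq s, size s = k & {in s, forall y, Y y}].
Proof.
move=> /pcard_leP[f].
exists [seq f i | i <- iota 0 k]; split.
- rewrite map_inj_in_uniq ?iota_uniq// => i j; rewrite !mem_iota !add0n => ik jk.
  by apply: inj; rewrite inE.
- by rewrite size_map size_iota.
- by move=> _ /mapP[i + ->]; rewrite mem_iota add0n => ik; apply: funS.
Qed.

Lemma not_eps_dense_far (R : realType) (d : nat) (eps e : R) (M : 'M[int]_d)
    (Y : set 'cV[R]_d) :
  0 < e <= 2^-1 -> e <= eps -> ~ eps_dense eps (torus_mul M @` (torus_proj @` Y)) ->
  exists x : 'cV[R]_d, forall y, Y y ->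
    exists j, ecos ((x - map_mx intr M *m y) j 0) <= ecos e.
Proof.
move=> e02 ee /existsNP[alpha far]; exists (repr alpha) => y Yy.
apply: torus_norm_gt_coord => //; apply: (le_lt_trans ee).
rewrite ltNge; apply/negP => close; apply: far.
exists (torus_mul M (torus_proj y)); first by exists (torus_proj y) => //; exists y.
by rewrite torus_mul_proj -[alpha]reprK -torus_projB.
Qed.

Theorem theoremD (R : realType) (eps : R) (d : nat) (A : 'M[{poly int}]_d) :
  0 < eps -> (0 < d)%N ->
  exists2 k : nat, (0 < k)%N &
    forall Yt : set 'cV[R]_d,
      (forall y, Yt y -> forall i, 0 <= y i 0 < 1) ->
      (`I_k #<= Yt)%card ->
      (forall (v : 'cV[int]_d) (y y' : 'cV[R]_d),
         v != 0 -> Yt y -> Yt y' -> y != y' ->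
         int_dot v (mulmx_poly (A - map_mx polyC (eval_mx A 0)) (y - y')) != 0) ->
      exists n : int,
        eps_dense eps (torus_mul (eval_mx A n) @` (torus_proj @` Yt)).
Proof.
move=> eps0 d0.
(* Distances to the nearest integer never exceed 1/2, and the cosine is monotone
   only up to there. *)
pose e := Num.min eps 2^-1.
have e02 : 0 < e <= 2^-1 by rewrite lt_min eps0 invr_gt0 ltr0n ge_min lexx orbT.
have e_eps : e <= eps by rewrite ge_min lexx.
have [V [c c0 [Vn0 Vfar]]] := fourier_obstruction d0 (ecos_lt1 e02).
pose D := (\max_r \max_m size (A r m))%N.
have AD r m : (size (A r m) <= D.+1)%N.
  by apply: leqW; rewrite (leq_trans _ (leq_bigmax r))// (leq_bigmax m).
set h : R := (size V).+1%:R.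
have h0 : 0 < h by rewrite ltr0n.
pose eta := (c / h) ^+ 2 / 2.
have eta0 : 0 < eta by rewrite divr_gt0// exprn_gt0// divr_gt0.
have [L L0 LP] := cancels_poly D (ltn0Sn 0) eta0.
pose N v := ((2 * (L * \sum_(l < D) phase_height A v l.+1)).+1 ^ D)%N.
set NV : R := \sum_(v <- V) (N v)%:R.
have NV0 : 0 <= NV by apply: sumr_ge0.
have [k k0 kP] : exists2 k : nat, (0 < k)%N & NV < k%:R * (c ^+ 2 / h / 2).
  have c1 : 0 < c ^+ 2 / h / 2 by rewrite !divr_gt0// exprn_gt0.
  exists (Num.bound (NV / (c ^+ 2 / h / 2))).+1 => //.
  rewrite -ltr_pdivrMr//; apply: lt_trans (archi_boundP _) _; last by rewrite ltr_nat.
  by rewrite divr_ge0// ltW.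
exists k => // Yt Yt01 /card_ge_uniq_seq[s [s_uniq s_size sY]] Yt_sep.
apply: contrapT => /forallNP not_dense.
pose E (n : int) := \sum_(v <- V) \sum_(y <- s) \sum_(y' <- s)
  ecos (phase A v (y' - y)).[n%:~R].
(* The missed centre x cancels in the differences, so that the bound depends
   on n alone. *)
have E_ge n : (k%:R * c) ^+ 2 / h <= E n.
  have [x xfar] := not_eps_dense_far e02 e_eps (not_dense n).
  rewrite -s_size.
  apply: le_trans (fourier_energy (u := fun y => x - map_mx intr (eval_mx A n) *m y) _ c0) _.
    by move=> y ys; apply/Vfar/xfar/sY.
  apply: ler_sum => v _; apply: ler_sum => y _; apply: ler_sum => y' _ /=.
  by rewrite horner_phase mulmxBr opprB [x - _ + _]addrC addrA subrK.
(* The average of the energy: cancellation for the generic pairs, the trivial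
   bound 1 for the exceptional ones. *)
have : mean_le 1 E (\sum_(v <- V) \sum_(y <- s) \sum_(y' <- s)
    (eta + (near_integral A D L v (y' - y))%:R)).
  apply: mean_le_sum => v vV; apply: mean_le_sum => y ys; apply: mean_le_sum => y' y's.
  have [_|/forallPn[l lN]] := boolP (near_integral A D L v (y' - y)).
    apply: mean_le_cst => n; apply: le_trans (ecos_le1 _) _.
    by rewrite lerDr ltW.
  rewrite addr0; apply: cancels_mean_le.
  have [all_int|//] := LP _ (size_phase v (y' - y) AD).
  by rewrite all_int in lN.
move=> /mean_le_exists[n]; apply/negP; rewrite -ltNge.
apply: lt_le_trans (E_ge n).
apply: (@le_lt_trans _ _ (\sum_(v <- V) (k%:R ^+ 2 * eta + k%:R * (N v)%:R))).
  rewrite big_seq [leRHS]big_seq; apply: ler_sum => v vV.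
  rewrite expr2 -mulrA -mulrDr -{1}s_size -sum_seq_cst.
  rewrite big_seq [leRHS]big_seq; apply: ler_sum => y ys.
  rewrite big_split/= sum_seq_cst s_size lerD2l -natr_sum ler_nat.
  rewrite -big_mkcond sum1_count.
  apply: count_near_integral => // [w ws m|w w' ws w's ww'].
    have /andP[w0 w1] := Yt01 _ (sY _ ws) m; have /andP[y0 y1] := Yt01 _ (sY _ ys) m.
    by rewrite !mxE ler_norml; lra.
  by apply: Yt_sep; rewrite ?Vn0//; exact: sY.
rewrite big_split/= sum_seq_cst -mulr_sumr -/NV.
have kk : 0 < k%:R :> R by rewrite ltr0n.
have hE : (size V)%:R = h - 1 :> R by rewrite /h -natr1 addrK.
have : k%:R * NV < k%:R * (k%:R * (c ^+ 2 / h / 2)) by rewrite ltr_pM2l.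
have : (size V)%:R * (k%:R ^+ 2 * eta) <= k%:R ^+ 2 * (c ^+ 2 / h / 2).
  rewrite hE (_ : k%:R ^+ 2 * (c ^+ 2 / h / 2) = h * (k%:R ^+ 2 * eta)).
    by rewrite ler_wpM2r ?lerBlDr ?lerDl// mulr_ge0 ?sqr_ge0// ltW.
  by rewrite /eta; field; rewrite gt_eqF.
rewrite (_ : (k%:R * c) ^+ 2 / h = 2 * (k%:R ^+ 2 * (c ^+ 2 / h / 2))).
  by move: (c ^+ 2 / h / 2) => x; lra.
by field; rewrite gt_eqF.
Qed.
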